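(* Let $(X,d_X,\mu_X)$ be an mm-space and let $\alpha\in(0,1)$. Then the following are equivalent. (1) There exists a point $x\in X$ such that $\mu_X(\{x\})\ge\alpha$. (2) $\operatorname{diam}(X;\alpha)=0$. (3) $\operatorname{ObsDiam}(X;\alpha)=0$.
   Context: An mm-space is a triple $(X,d_X,\mu_X)$ where $(X,d_X)$ is a complete separable metric space and $\mu_X$ is a Borel probability measure on $X$. For an mm-space $X$ and $\alpha\ge 0$, the $\alpha$-partial diameter is $$\operatorname{diam}(X;\alpha)=\operatorname{diam}(\mu_X;\alpha):=\inf\{\operatorname{diam}A\mid A\subset X \text{ Borel with }\mu_X(A)\ge\alpha\},$$ and the $\alpha$-observable diameter is $$\operatorname{ObsDiam}(X;\alpha):=\sup\{\operatorname{diam}(f_*\mu_X;\alpha)\mid f:X\to\mathbb{R}\ \text{is 1-Lipschitz}\},$$ where $f_*\mu_X$ is the push-forward measure on $\mathbb{R}$ (with its usual metric). *)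

(* Defs.v *)
From HB Require Import structures.
From mathcomp Require Import all_boot all_order all_algebra.
From mathcomp Require Import all_classical all_reals all_analysis.

Set Implicit Arguments.
Unset Strict Implicit.
Unset Printing Implicit Defensive.

Import Order.TTheory GRing.Theory Num.Theory.
Import numFieldNormedType.Exports.

Local Open Scope classical_set_scope.
Local Open Scope ring_scope.

(* The base point carries no information: it is required by the library's
   measurable types, and an mm-space is nonempty since its total mass is 1. *)
#[short(type="pmetricType")]
HB.structure Definition PointedMetric (R : numDomainType) :=
  {T of Pointed T & Metric R T}.

#[short(type="completePMetricType")]
HB.structure Definition CompletePointedMetric (R : numDomainType) :=
  {T of PointedMetric R T & Complete T}.

HB.instance Definition _ (R : realType) := Pointed.on R^o.

Definition separable (T : topologicalType) :=
  exists2 D : set T, countable D & dense D.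

Definition borelType (T : ptopologicalType) := g_sigma_algebraType (@open T).

Definition lipschitz1 (R : numDomainType) (X Y : metricType R) (f : X -> Y) :=
  forall x y, mdist (f x) (f y) <= mdist x y.

Section mm_space_invariants.
Context {R : realType}.
Local Open Scope ereal_scope.

(* [maxe 0] only makes a difference for the empty set, whose [ereal_sup] is
   [-oo]: it forces the diameter of the empty set to be 0. *)
Definition diam (X : metricType R) (A : set X) : \bar R :=
  maxe 0 (ereal_sup [set (mdist p.1 p.2)%:E | p in A `*` A]).

Definition partial_diam (X : pmetricType R) (mu : set (borelType X) -> \bar R)
    (alpha : R) : \bar R :=
  ereal_inf [set diam A | A in
    [set A : set (borelType X) | measurable A /\ alpha%:E <= mu A]].

Definition obs_diam (X : pmetricType R) (mu : set (borelType X) -> \bar R)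
    (alpha : R) : \bar R :=
  ereal_sup [set @partial_diam R^o
      (pushforward mu (f : borelType X -> borelType R^o)) alpha
    | f in [set f : X -> R^o | lipschitz1 f]].

End mm_space_invariants.

(* Main.v *)
(* The substantial implication is (3) => (1). There are 1-Lipschitz functions
   [f k] such that any two distinct points are separated by all but finitely
   many of them. If the observable diameter vanishes, each [f k] has a level
   set [L k] of mass at least [alpha]. Since mu (limsup L) >= alpha > 0, some
   [x] lies in infinitely many [L k]; the upper limit of these has mass at least
   [alpha] as well, and it is [{x}], because [y] in infinitely many of them means
   that infinitely many [f k] fail to separate [x] and [y]. The same argument,
   applied to preimages of sets of diameter less than [1 / k], provides the
   level sets. *)
Require Import Defs.
From HB Require Import structures.
From mathcomp Require Import all_boot all_order all_algebra.
From mathcomp Require Import all_classical all_reals all_analysis.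
From mathcomp Require Import lra.

Set Implicit Arguments.
Unset Strict Implicit.
Unset Printing Implicit Defensive.

Import Order.TTheory GRing.Theory Num.Theory.
Import numFieldNormedType.Exports.

Local Open Scope classical_set_scope.
Local Open Scope ring_scope.

(** * Measure of an upper limit of sets *)

Section limsup_measure.
Context d (T : measurableType d) (R : realType).
Variable mu : {finite_measure set T -> \bar R}.
Local Open Scope ereal_scope.

Lemma measurable_lim_sup_set (F : (set T)^nat) :
  (forall k, measurable (F k)) -> measurable (lim_sup_set F).
Proof.
by move=> mF; apply: bigcapT_measurable => n; exact: bigcup_measurable.
Qed.

(** The unions over [k >= n] decrease to the upper limit, and each contains some [F k] of mass at
    least [a]; since [mu] is finite, it is continuous from above along them. *)
Lemma lim_sup_set_measure_ge (F : (set T)^nat) (a : \bar R) :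
  (forall k, measurable (F k)) ->
  (forall n, exists2 k, (n <= k)%N & a <= mu (F k)) ->
  a <= mu (lim_sup_set F).
Proof.
move=> mF aF.
have mU n : measurable (\bigcup_(k >= n) F k) by exact: bigcup_measurable.
have muF : mu (\bigcup_(k >= 0) F k) < +oo.
  by rewrite -ge0_fin_numE// fin_num_measure.
have Fcvg := lim_sup_set_cvg mu F mF muF.
rewrite -(cvg_lim _ Fcvg)//; apply: lime_ge.
  by apply/cvg_ex; eexists; exact: Fcvg.
apply: nearW => n; have [k nk ak] := aF n.
by apply: (le_trans ak); rewrite le_measure ?inE//; exact: bigcup_sup.
Qed.

(* By the reverse Fatou inequality some point lies in infinitely many [F k];
   applying the inequality again along those [k] gives the claim. *)
Lemma recurrent_point (F : (set T)^nat) (a : \bar R) : 0 < a ->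
  (forall k, measurable (F k)) -> (forall k, a <= mu (F k)) ->
  exists x, forall B, measurable B ->
    lim_sup_set (fun k => [set y | F k x /\ F k y]) `<=` B -> a <= mu B.
Proof.
move=> a0 mF aF.
have : lim_sup_set F !=set0.
  apply/set0P/eqP => F0.
  have : a <= mu (lim_sup_set F).
    by apply: lim_sup_set_measure_ge => // n; exists n.
  by rewrite F0 measure0 leNgt a0.
move=> [x Fx]; exists x => B mB FB.
(* The set [[set y | F k x /\ F k y]] is [F k] if [x] lies in [F k] and empty otherwise, so the
   upper limit of these sets is taken along the [k] with [F k x]. *)
have FxE k : F k x -> [set y | F k x /\ F k y] = F k.
  by move=> Fkx; apply/seteqP; split=> [y []//|y].
have mFx k : measurable [set y | F k x /\ F k y].
  have [/FxE->//|nFkx] := pselect (F k x).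
  by rewrite (_ : mkset _ = set0)//; apply/seteqP; split=> [y []|].
apply: (@le_trans _ _ (mu (lim_sup_set (fun k => [set y | F k x /\ F k y])))).
  apply: lim_sup_set_measure_ge => // n.
  by have [k /= nk Fkx] := Fx n I; exists k; rewrite ?FxE.
by rewrite le_measure ?inE//; exact: measurable_lim_sup_set.
Qed.

End limsup_measure.

(** * Borel sets and 1-Lipschitz maps *)

Section borel.
Context (R : realType).

Lemma metric_ball_open (X : metricType R) (x : X) (e : R) : open (ball x e).
Proof.
rewrite openE => y; rewrite ballEmdist/= => xy.
apply/metricType_numDomainType.nbhs_mdistP.
exists (e - mdist x y) => [|z /= yz]; first by rewrite /= subr_gt0.
by rewrite (le_lt_trans (metric_triangle _ y _))// -ltrBrDl.
Qed.

Lemma open_borel_measurable (X : pmetricType R) (A : set X) :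
  open A -> measurable (A : set (borelType X)).
Proof. by move=> oA; exact: sub_sigma_algebra. Qed.

Lemma set1_borel_measurable (X : pmetricType R) (x : X) :
  measurable ([set x] : set (borelType X)).
Proof.
have : closed [set x].
  by apply: accessible_closed_set1; exact/hausdorff_accessible/metric_hausdorff.
by move/closed_openC/open_borel_measurable/measurableC; rewrite setCK.
Qed.

Lemma lipschitz1_continuous (X Y : metricType R) (f : X -> Y) :
  lipschitz1 f -> continuous f.
Proof.
move=> lf x; apply/metricType_numDomainType.fcvgrPdist_lt => e e0.
apply/metricType_numDomainType.nbhs_mdistP.
by exists e => //= y; exact: le_lt_trans.
Qed.

Lemma lipschitz1_measurable (X Y : pmetricType R) (f : X -> Y) :
  lipschitz1 f ->
  measurable_fun setT (f : borelType X -> borelType Y).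
Proof.
move=> /lipschitz1_continuous/continuousP cf.
apply: (@measurability _ _ (borelType X) (borelType Y) setT f (@open Y)) => //.
move=> _ [B oB <-].
by rewrite setTI; apply: open_borel_measurable; exact: cf.
Qed.

End borel.

(** * Vanishing partial diameter *)

Section partial_diameter.
Context (R : realType).

Lemma partial_diam_ge0 (X : pmetricType R) (mu : set (borelType X) -> \bar R)
  (alpha : R) : (0 <= partial_diam mu alpha)%E.
Proof.
by apply: le_ereal_inf_tmp => _ [A _ <-]; rewrite /diam le_max lexx.
Qed.

Lemma partial_diam_eq0P (X : pmetricType R) (mu : set (borelType X) -> \bar R)
  (alpha : R) :
  partial_diam mu alpha = 0%E <->
  forall e : R, 0 < e -> exists A : set (borelType X),
    [/\ measurable A, (alpha%:E <= mu A)%E &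
        forall x y : X, A x -> A y -> mdist x y < e].
Proof.
split=> [mu0 e e0|small].
  have : (partial_diam mu alpha < e%:E)%E by rewrite mu0 lte_fin.
  move=> /ereal_inf_lt[_ [A [mA aA] <-] Ae]; exists A; split=> // x y Ax Ay.
  rewrite -lte_fin; apply: le_lt_trans Ae.
  by rewrite /diam le_max; apply/orP; right; apply: ereal_sup_ubound;
    exists (x, y).
apply/eqP; rewrite eq_le partial_diam_ge0 andbT.
apply/lee_addgt0Pr => e e0; rewrite add0e.
have [A [mA aA Ae]] := small _ e0.
apply: (@le_trans _ _ (diam A)); first by apply: ereal_inf_lbound; exists A.
rewrite /diam ge_max lee_fin ltW//=.
by apply: ge_ereal_sup => _ [[x y] [/= Ax Ay] <-]; rewrite lee_fin ltW// Ae.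
Qed.

(** The image of a Borel set [A] need not be Borel, so an open ball around [f a], with [a] in [A],
    replaces it; [A] is nonempty because [alpha > 0]. *)
Lemma partial_diam_pushforward_eq0 (X Y : pmetricType R)
  (mu : {measure set (borelType X) -> \bar R}) (alpha : R) (f : X -> Y) :
  0 < alpha -> lipschitz1 f -> partial_diam mu alpha = 0%E ->
  partial_diam (pushforward mu (f : borelType X -> borelType Y)) alpha = 0%E.
Proof.
move=> alpha0 lf /partial_diam_eq0P small; apply/partial_diam_eq0P => e e0.
have e20 : 0 < e / 2 by rewrite divr_gt0.
have [A [mA aA Ae]] := small _ e20.
have [a Aa] : A !=set0.
  by apply/set0P/eqP => A0; move: aA; rewrite A0 measure0 lee_fin leNgt alpha0.
have mB : measurable (ball (f a) (e / 2) : set (borelType Y)).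
  by apply: open_borel_measurable; exact: metric_ball_open.
exists (ball (f a) (e / 2)); split=> // [|x y].
  apply: (le_trans aA); rewrite /pushforward le_measure ?inE//.
    by rewrite -[X in measurable X]setTI; exact: lipschitz1_measurable.
  by move=> x Ax; rewrite ballEmdist/=; apply: le_lt_trans (lf _ _) _; exact: Ae.
rewrite !ballEmdist/= => fx fy; apply: le_lt_trans (metric_triangle _ (f a) _) _.
by rewrite [ltRHS]splitr ltrD// metric_sym.
Qed.

(** If [y] shares with a recurrent point [x] infinitely many preimages of sets [A k] of diameter at
    most [1 / (k + 1)], then [f y = f x]. *)
Lemma pushforward_atom (X Y : pmetricType R)
  (mu : {finite_measure set (borelType X) -> \bar R}) (alpha : R)
  (f : X -> Y) :
  0 < alpha -> lipschitz1 f ->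
  partial_diam (pushforward mu (f : borelType X -> borelType Y)) alpha = 0%E ->
  exists x, (alpha%:E <= mu (f @^-1` [set f x]))%E.
Proof.
move=> alpha0 lf /partial_diam_eq0P small.
have mf A : measurable (A : set (borelType Y)) ->
    measurable (f @^-1` A : set (borelType X)).
  by rewrite -[X in _ -> measurable X]setTI; exact: lipschitz1_measurable.
have /choice[A AP] (k : nat) : exists A : set (borelType Y),
    [/\ measurable A, (alpha%:E <= mu (f @^-1` A))%E &
        forall x y : Y, A x -> A y -> mdist x y < k.+1%:R^-1].
  by apply: small; rewrite invr_gt0.
have mA k : measurable (f @^-1` A k : set (borelType X)).
  by apply: mf; have [] := AP k.
have [||x Hx] := @recurrent_point _ _ _ mu (fun k => f @^-1` A k) alpha%:E _ mA.
- by rewrite lte_fin.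
- by move=> k; have [] := AP k.
exists x; apply: Hx; first by apply: mf; exact: set1_borel_measurable.
move=> y Hy /=; apply: contrapT => /eqP fxy.
have d0 : 0 < mdist (f y) (f x) by rewrite mdist_gt0.
have [N _ NP] := near_infty_natSinv_lt (PosNum d0).
have [k /= Nk [Akx Aky]] := Hy N I.
have [_ _ /(_ _ _ Aky Akx)] := AP k.
by rewrite ltNge ltW//; exact: NP.
Qed.

End partial_diameter.

(** * A sequence of 1-Lipschitz functions that separates points *)

Section separating_sequence.
Context (R : realType) (X : metricType R) (g : nat -> X -> R).

(* [\sum_(i < j) t ^+ i.+1 * g (n + i) x], in Horner form. *)
Fixpoint horner_sum (t : R) (j n : nat) (x : X) : R :=
  if j is i.+1 then t * (g n x + horner_sum t i n.+1 x) else 0.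

Hypothesis lip_g : forall n x y, `|g n x - g n y| <= mdist x y.

(** Induction closes because [t * (1 + 2 * t) <= 2 * t] for [t <= 1 / 2]. *)
Lemma horner_sum_lip t j n x y : 0 <= t -> t <= 2^-1 ->
  `|horner_sum t j n x - horner_sum t j n y| <= 2 * t * mdist x y.
Proof.
move=> t0 t2; elim: j n => [|j IH] n /=.
  by rewrite subrr normr0 !mulr_ge0 ?mdist_ge0.
rewrite -mulrBr normrM (ger0_norm t0) opprD addrACA [2 * t]mulrC -mulrA.
rewrite ler_wpM2l// (le_trans (ler_normD _ _))// mulrDl mul1r lerD//.
rewrite (le_trans (IH _))// -[leRHS]mul1r ler_wpM2r ?mdist_ge0//; lra.
Qed.

(** The first [m] terms cancel; by [horner_sum_lip] the inner sum after [g (n + m)] varies by at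
    most [2 * t * mdist x y], too little to offset the gap there. *)
Lemma horner_sum_neq t m j n x y : 0 < t -> t <= 2^-1 -> (m < j)%N ->
  (forall i, (i < m)%N -> g (n + i) x = g (n + i) y) ->
  2 * t * mdist x y < `|g (n + m) x - g (n + m) y| ->
  horner_sum t j n x != horner_sum t j n y.
Proof.
move=> t0 t2; elim: m j n => [|m IH] [|j] n//= mj gE gm.
  rewrite addn0 in gm; apply/eqP => /(mulfI (lt0r_neq0 t0)) E.
  have := horner_sum_lip j n.+1 x y (ltW t0) t2.
  rewrite leNgt distrC (_ : _ - _ = g n x - g n y) ?gm//.
  by move: E; lra.
rewrite (inj_eq (mulfI (lt0r_neq0 t0))).
rewrite -[n in g n x]addn0 -[n in g n y]addn0 gE// (inj_eq (addrI _)).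
by apply: IH => // [i im|]; rewrite addSnnS// gE.
Qed.

End separating_sequence.

Lemma separable_seq (X : ptopologicalType) : separable X ->
  exists e : nat -> X, dense (range e).
Proof.
(* An empty [D] is not dense, as the whole space contains the base point. *)
move=> [D cD dD]; move: cD => /pfcard_geP[D0|[e]].
  have [x [_]] := dD setT (ex_intro _ point I) openT.
  by rewrite D0.
exists e => O O0 oO; have [x [Ox Dx]] := dD O O0 oO.
by exists x; split=> //; have [n _ <-] := @surj _ _ _ _ e x Dx; exists n.
Qed.

(* The functions [\sum_(i < k) t_k ^+ i.+1 * mdist (e i) x], where [e] is a
   dense sequence and [t_k = 1 / (k + 2)]: for distinct [x] and [y], the first
   index at which the distances differ dominates as [t_k] tends to 0. *)
Lemma lipschitz1_separating_seq (R : realType) (X : pmetricType R) :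
  separable X -> exists f : nat -> X -> R^o,
    (forall k, lipschitz1 (f k)) /\
    forall x y, x != y -> \forall k \near \oo, f k x != f k y.
Proof.
move=> /separable_seq[e de]; pose g n (x : X) : R := mdist (e n) x.
have lip_g n x y : `|g n x - g n y| <= mdist x y.
  have := metric_triangle (e n) x y; have := metric_triangle (e n) y x.
  by rewrite (metric_sym y x) ler_norml /g; lra.
(* Starting at [1 / 2] makes the Lipschitz constant [2 * t k] at most 1 for every [k]. *)
pose t k : R := k.+2%:R^-1.
have t0 k : 0 < t k by rewrite invr_gt0.
have t2 k : t k <= 2^-1 by rewrite lef_pV2 ?posrE// ler_nat.
exists (fun k => horner_sum g (t k) k 0); split=> [k x y|x y xy].
  apply: (le_trans (horner_sum_lip lip_g k 0 y x (ltW (t0 k)) (t2 k))).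
  by rewrite metric_sym -[leRHS]mul1r ler_wpM2r ?mdist_ge0//; have := t2 k; lra.
have d0 : 0 < mdist x y by rewrite mdist_gt0.
have [m gm mmin] : exists2 m, g m x != g m y &
    forall i, (i < m)%N -> g i x = g i y.
  have ex_m : exists m, g m x != g m y.
    (* A point closer to [x] than half of [mdist x y] cannot be equidistant from [x] and [y]. *)
    have [z [zx [m _ emz]]] : ball x (mdist x y / 2) `&` range e !=set0.
      apply: de; last exact: metric_ball_open.
      by exists x; apply: ballxx; rewrite divr_gt0.
    exists m; rewrite /g emz; apply/eqP => zxy.
    move: zx; rewrite ballEmdist/= => zx.
    by have := metric_triangle x z y; rewrite -zxy (metric_sym z x); lra.
  case: (ex_minnP ex_m) => m gm mmin; exists m => // i im.
  by apply/eqP; apply: contraTT im => /mmin; rewrite -leqNgt.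
have c0 : 0 < `|g m x - g m y| / (2 * mdist x y).
  by rewrite divr_gt0 ?mulr_gt0// normr_gt0 subr_eq0.
have [N _ NP] := near_infty_natSinv_lt (PosNum c0).
(* [N] makes [t k] small against the gap at [m]; [m.+1] ensures that the sum of [k] terms reaches
   index [m]. *)
exists (maxn N m.+1) => // k /=; rewrite geq_max => /andP[Nk mk].
apply: (horner_sum_neq lip_g (m := m)) => //.
have : t k < `|g m x - g m y| / (2 * mdist x y).
  by apply: NP => /=; exact: leqW.
by rewrite ltr_pdivlMr ?mulr_gt0// mulrCA mulrA.
Qed.

Theorem theorem1p1 (R : realType) (X : completePMetricType R)
    (sepX : separable X) (mu : probability (borelType X) R)
    (alpha : R) (alpha_gt0 : 0 < alpha) (alpha_lt1 : alpha < 1) :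
  [<-> exists x : X, (alpha%:E <= mu [set x])%E;
       partial_diam mu alpha = 0%E;
       obs_diam mu alpha = 0%E].
Proof.
split; [|split].
- move=> [x mux]; apply/partial_diam_eq0P => e e0.
  exists [set x]; split=> //; first exact: set1_borel_measurable.
  by move=> _ _ -> ->; rewrite mdistxx.
- move=> mu0; apply/eqP; rewrite eq_le; apply/andP; split.
    apply: ge_ereal_sup => _ [f lf <-].
    by rewrite partial_diam_pushforward_eq0.
  (* A constant function keeps the supremum from being that of an empty family, [-oo]. *)
  apply: (@le_trans _ _ (partial_diam (pushforward mu
    ((cst 0 : X -> R^o) : borelType X -> borelType R^o)) alpha)).
    exact: partial_diam_ge0.
  apply: ereal_sup_ubound; exists (cst 0) => // x y.
  by rewrite mdistxx mdist_ge0.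
- move=> obs0; have [f [lf sepf]] := lipschitz1_separating_seq sepX.
  have /choice[x xP] k :
      exists x, (alpha%:E <= mu (f k @^-1` [set f k x]))%E.
    apply: pushforward_atom => //.
    apply/eqP; rewrite eq_le partial_diam_ge0 andbT -obs0.
    by apply: ereal_sup_ubound; exists (f k); first exact: lf.
  pose L k : set (borelType X) := f k @^-1` [set f k (x k)].
  have mL k : measurable (L k).
    rewrite -[X in measurable X]setTI.
    by apply: lipschitz1_measurable => //; exact: set1_borel_measurable.
  have [||z Lz] := @recurrent_point _ _ _ mu L alpha%:E _ mL.
  + by rewrite lte_fin.
  + exact: xP.
  exists z; apply: Lz; first exact: set1_borel_measurable.
  move=> y Ly /=; apply: contrapT => /eqP/sepf[N _ NP].
  have [k /= Nk [Lkz Lky]] := Ly N I.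
  by have := NP k Nk; rewrite Lky Lkz eqxx.
Qed.
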